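(* Suppose that $X$ is a discretely infinitely divisible random variable with distribution function $F$, so that $X$ is compound Poisson, i.e. $X$ has the same distribution as $\sum_{i=1}^{\Pi}Y_i$ where $\Pi$ is Poisson with parameter $\lambda>0$ and $Y_1,Y_2,\ldots$ are independent, identically distributed, independent of $\Pi$, and take values in the positive integers. Suppose that $\operatorname{supp}(Y_i)$ is arithmetic with span $\nu\in N$. Then: (i) $\operatorname{supp}(F)$ has at most finitely many gaps. (ii) $\operatorname{supp}(F)$ has no gaps if and only if $F(\{\nu\})>0$, where $F(\{\nu\})=P\{X=\nu\}$.
   Context: $N$ is the set of positive integers and $Z_+$ the set of nonnegative integers. $\operatorname{supp}(X)$ or $\operatorname{supp}(F)$ denotes the support of a random variable $X$ or of its distribution function $F$. A $Z_+$-valued random variable $X$ is discretely infinitely divisible (DID) if for every $n\in N$ there exists a $Z_+$-valued random variable $X_n$ such that $X$ has the same distribution as $X_{n,1}+\cdots+X_{n,n}$, where the $X_{n,i}$ are independent copies of $X_n$. A DID random variable is compound Poisson: its probability generating function is $P(s)=\exp\{-\lambda[1-Q(s)]\}$, with $Q$ a probability generating function (that of the jump $Y_i$, with the convention $P(Y_i=0)=0$) and $\lambda>0$. $\operatorname{supp}(Y_i)$ is arithmetic with span $\nu$ if $\nu$ is the greatest common divisor of $\operatorname{supp}(Y_i)$. Gaps are understood relative to the lattice $\nu Z_+=\{j\nu: j\in Z_+\}$: $\operatorname{supp}(X)=\operatorname{supp}(F)$ has no gaps if $P\{X=j\nu\}>0$ for all $j\in Z_+$; a gap is a maximal nonempty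 run of consecutive elements of $\nu Z_+$ not belonging to $\operatorname{supp}(X)$. *)

(* Defs.v *)
From HB Require Import structures.
From mathcomp Require Import all_boot all_order all_algebra.
From mathcomp Require Import all_classical all_reals all_analysis.

Set Implicit Arguments.
Unset Strict Implicit.
Unset Printing Implicit Defensive.

Import Order.TTheory GRing.Theory Num.Theory.

Local Open Scope classical_set_scope.

(** * Sums of random variables with values in the nonnegative integers *)

Section sums.
Context d (T : measurableType d).

Definition finite_sum n (X : 'I_n -> {mfun T >-> nat}) : T -> nat :=
  fun w => (\sum_(i < n) X i w)%N.

(* With Y indexed from 0, this is Y_1 + ... + Y_N for a random number N of
   terms. *)
Definition random_sum (N : {mfun T >-> nat}) (Y : nat -> {mfun T >-> nat}) :
    T -> nat :=
  fun w => (\sum_(i < N w) Y i w)%N.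

Lemma measurable_addn (f g : T -> nat) :
  measurable_fun [set: T] f -> measurable_fun [set: T] g ->
  measurable_fun [set: T] (fun w => (f w + g w)%N).
Proof.
move=> mf mg _ A _; rewrite setTI.
have -> : (fun w => (f w + g w)%N) @^-1` A =
    \bigcup_m ((f @^-1` [set m]) `&` (g @^-1` [set n | A (m + n)%N])).
  apply/seteqP; split=> [w Aw|w [m _ [/= -> //]]].
  by exists (f w) => //; split.
apply: bigcup_measurable => m _; apply: measurableI.
- by rewrite -[X in measurable X]setTI; apply: mf.
- by rewrite -[X in measurable X]setTI; apply: mg.
Qed.

Lemma measurable_sumn n (X : nat -> T -> nat) :
  (forall i, measurable_fun [set: T] (X i)) ->
  measurable_fun [set: T] (fun w => \sum_(i < n) X i w)%N.
Proof.
move=> mX; elim: n => [|n IHn].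
  by under eq_fun do rewrite big_ord0; exact: measurable_cst.
by under eq_fun do rewrite big_ord_recr /=; exact: measurable_addn.
Qed.

Lemma measurable_finite_sum n (X : 'I_n -> {mfun T >-> nat}) :
  measurable_fun [set: T] (finite_sum X).
Proof.
rewrite /finite_sum; elim: n X => [|n IHn] X.
  by under eq_fun do rewrite big_ord0; exact: measurable_cst.
under eq_fun do rewrite big_ord_recr /=.
by apply: measurable_addn => //; exact: (IHn (fun i => X (widen_ord _ i))).
Qed.

Lemma measurable_random_sum N (Y : nat -> {mfun T >-> nat}) :
  measurable_fun [set: T] (random_sum N Y).
Proof.
move=> _ A _; rewrite setTI.
have -> : random_sum N Y @^-1` A =
    \bigcup_n ((N @^-1` [set n]) `&`
               ((fun w => \sum_(i < n) Y i w)%N @^-1` A)).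
  apply/seteqP; split=> [w Aw|w [n _ [/= <-]]] //.
  by exists (N w) => //; split.
apply: bigcup_measurable => n _; apply: measurableI.
- by rewrite -[X in measurable X]setTI; exact: measurable_funPT.
- rewrite -[X in measurable X]setTI.
  by apply: (@measurable_sumn n (fun i => Y i)).
Qed.

HB.instance Definition _ n X :=
  isMeasurableFun.Build _ _ _ _ (@finite_sum n X) (measurable_finite_sum X).

HB.instance Definition _ N Y :=
  isMeasurableFun.Build _ _ _ _ (random_sum N Y) (measurable_random_sum N Y).

End sums.

(** * Independence and discrete infinite divisibility *)

Definition mutually_independent (R : realType) (I : eqType) d
    (T : measurableType d) d' (T' : measurableType d') (P : probability T R)
    (X : I -> {RV P >-> T'}) : Prop :=
  forall (s : seq I) (A : I -> set T'),
    uniq s -> (forall i, measurable (A i)) ->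
    P (\bigcap_(i in [set` s]) (X i @^-1` A i)) =
    (\prod_(i <- s) P (X i @^-1` A i))%E.

(* The independent copies may live on another probability space. *)
Definition discretely_infinitely_divisible (R : realType) d
    (T : measurableType d) (P : probability T R) (X : {RV P >-> nat}) : Prop :=
  forall n : nat, (0 < n)%N ->
    exists (d' : measure_display) (T' : measurableType d')
      (P' : probability T' R) (Xn : 'I_n -> {RV P' >-> nat}),
      [/\ mutually_independent Xn,
          forall i j, distribution P' (Xn i) = distribution P' (Xn j) &
          distribution P X = distribution P' (finite_sum Xn)].

(** * Compound Poisson representation *)

Definition counter_and_jumps (R : realType) d (T : measurableType d)
    (P : probability T R) (N : {RV P >-> nat}) (Y : nat -> {RV P >-> nat})
    (k : nat) : {RV P >-> nat} :=
  if k is i.+1 then Y i else N.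

(* The distribution of X is that of Y_1 + ... + Y_N. That the jumps are
   positive integers is required almost surely. *)
Definition compound_poisson_repr (R : realType) d (T : measurableType d)
    (P : probability T R) (X : {RV P >-> nat}) (lambda : R)
    d' (T' : measurableType d') (P' : probability T' R)
    (N : {RV P' >-> nat}) (Y : nat -> {RV P' >-> nat}) : Prop :=
  [/\ forall k : nat, distribution P' N [set k] = (poisson_pmf lambda k)%:E,
      forall i, distribution P' (Y i) = distribution P' (Y 0%N),
      forall i, distribution P' (Y i) [set 0%N] = 0%E,
      mutually_independent (counter_and_jumps N Y) &
      distribution P X = distribution P' (random_sum N Y)].

(** * Supports, span and gaps *)

Definition supp (R : realType) (F : set nat -> \bar R) : set nat :=
  [set k | (0 < F [set k])%E].

Definition is_gcd_of (S : set nat) (nu : nat) : Prop :=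
  (forall k, S k -> (nu %| k)%N) /\
  (forall m : nat, (forall k, S k -> (m %| k)%N) -> (m %| nu)%N).

Definition lattice (nu : nat) : set nat := [set (j * nu)%N | j in [set: nat]].

(* A run of consecutive lattice points is an order-convex part of the lattice;
   it may be infinite. *)
Definition missing_run (nu : nat) (S G : set nat) : Prop :=
  [/\ G !=set0, G `<=` lattice nu,
      forall a b c, G a -> G c -> lattice nu b -> (a <= b <= c)%N -> G b &
      G `&` S = set0].

Definition is_gap (nu : nat) (S G : set nat) : Prop :=
  missing_run nu S G /\
  forall G', missing_run nu S G' -> G `<=` G' -> G' = G.

Definition no_gaps (nu : nat) (S : set nat) : Prop :=
  forall j : nat, S (j * nu)%N.

(* Main.v *)
(** The support of a compound Poisson variable is the additive submonoid of
    nat generated by the support of the jumps.  A submonoid of nat whose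
    generators have greatest common divisor nu > 0 contains all large multiples
    of nu, so every gap lies in one bounded interval; and it contains all
    multiples of nu as soon as it contains nu. *)

Require Import Defs.
From mathcomp Require Import all_boot all_order all_algebra.
From mathcomp Require Import all_classical all_reals all_analysis.
Import Order.TTheory GRing.Theory Num.Theory.
Local Open Scope classical_set_scope.
Local Open Scope ring_scope.

(** Finite lists describe the generated submonoid so that the entries of [s] can serve as the values
    of successive jumps, and [size s] as the value of the counter. *)
Definition submonoid (A : set nat) : set nat :=
  [set k | exists2 s : seq nat, (forall x, x \in s -> A x) & sumn s = k].

Lemma submonoid0 (A : set nat) : submonoid A 0%N.
Proof. by exists [::]. Qed.

Lemma submonoid_gen (A : set nat) k : A k -> submonoid A k.
Proof.
move=> Ak; exists [:: k]; last by rewrite /= addn0.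
by move=> x; rewrite inE => /eqP ->.
Qed.

Lemma submonoidD (A : set nat) m n :
  submonoid A m -> submonoid A n -> submonoid A (m + n)%N.
Proof.
move=> [s As <-] [t At <-]; exists (s ++ t); last by rewrite sumn_cat.
by move=> x; rewrite mem_cat => /orP[/As|/At].
Qed.

Lemma submonoidM (A : set nat) m j : submonoid A m -> submonoid A (j * m)%N.
Proof.
move=> Am; elim: j => [|j IHj]; first exact: submonoid0.
by rewrite mulSn; exact: submonoidD.
Qed.

Lemma dvdn_submonoid (A : set nat) nu m :
  (forall k, A k -> (nu %| k)%N) -> submonoid A m -> (nu %| m)%N.
Proof.
move=> nuA [s As <-]; elim: s As => [|a s IHs] As; first by rewrite dvdn0.
rewrite dvdn_addr; first by apply: IHs => x xs; apply: As; rewrite inE xs orbT.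
by apply/nuA/As; rewrite inE eqxx.
Qed.

(* The differences of elements of the submonoid are closed under truncated
   subtraction, hence they are the multiples of the least positive one. *)
Lemma gcd_difference (A : set nat) nu : (0 < nu)%N -> is_gcd_of A nu ->
  exists2 m, submonoid A m & submonoid A (m + nu)%N.
Proof.
move=> nu0 [nuA gcdA].
pose D : set nat := [set e | exists2 m, submonoid A m & submonoid A (m + e)%N].
have DA k : A k -> D k.
  by move=> /submonoid_gen Ak; exists 0%N => //; exact: submonoid0.
have D0 : D 0%N by exists 0%N; exact: submonoid0.
have DD a b : D a -> D b -> D (a + b)%N.
  move=> [m Am Ama] [n An Anb]; exists (m + n)%N; first exact: submonoidD.
  by rewrite addnACA; exact: submonoidD.
(* Both [m + (n + b)] and [(m + (a + b)) + n] lie in the submonoid, and they differ by [a]. *)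
have DB a b : D (a + b)%N -> D b -> D a.
  move=> [m Am Amab] [n An Anb]; exists (m + (n + b))%N.
    exact: submonoidD.
  have -> : (m + (n + b) + a = m + (a + b) + n)%N.
    by rewrite -!addnA; congr addn; rewrite [in LHS]addnC (addnC b) addnA.
  exact: submonoidD.
have DM a j : D a -> D (j * a)%N.
  by move=> Da; elim: j => [|j IHj] //; rewrite mulSn; exact: DD.
(* Otherwise [A] contains at most 0, so every integer divides all of [A], and [nu + nu] would divide
   [nu]. *)
have [k Ak k0] : exists2 k, A k & (0 < k)%N.
  apply: contrapT => nA; have : (nu + nu %| nu)%N.
    apply: gcdA => k Ak; case: (posnP k) => [->|k0]; first exact: dvdn0.
    by case: nA; exists k.
  by move=> /(dvdn_leq nu0);
    rewrite -[X in (_ <= X)%N]addn0 leq_add2l leqNgt nu0.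
have exg : exists g, `[< D g /\ (0 < g)%N >].
  by exists k; apply/asboolP; split => //; exact: DA.
case: (ex_minnP exg) => g /asboolP[Dg g0] gmin.
suff /dvdnP[j ->] : (g %| nu)%N by exact: DM.
(* A nonzero remainder of [a] modulo [g] would be a positive difference smaller than [g]. *)
apply: gcdA => a /DA Da; rewrite /dvdn; case: posnP => // r0.
have /gmin : `[< D (a %% g)%N /\ (0 < a %% g)%N >].
  apply/asboolP; split => //; apply: (DB _ (a %/ g * g)%N); last exact: DM.
  by rewrite addnC -divn_eq.
by rewrite leqNgt ltn_mod g0.
Qed.

(** Let [m] and [m + nu] lie in the submonoid, with [m = q * nu]. Writing [j = t * q + r] with
    [r < q] gives [j * nu = (t - r) * m + r * (m + nu)], a legitimate combination once [r <= t]. The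
    bound [q * q <= j] ensures this, since then [r < q <= t]. *)
Lemma submonoid_cofinite (A : set nat) nu : (0 < nu)%N -> is_gcd_of A nu ->
  exists K, forall j, (K <= j)%N -> submonoid A (j * nu)%N.
Proof.
move=> nu0 gA; have [m Am Amnu] := gcd_difference A nu nu0 gA.
have /dvdnP[q mE] := dvdn_submonoid A nu m gA.1 Am.
(* If [q = 0] then [m = 0], so [nu] itself lies in the submonoid. *)
have [q0|q0] := posnP q.
  by exists 0%N => j _; apply: submonoidM; rewrite mE q0 in Amnu.
exists (q * q)%N => j qj.
have rt : (j %% q <= j %/ q)%N.
  by rewrite (leq_trans (ltnW (ltn_pmod j q0)))// leq_divRL.
have -> : (j * nu = (j %/ q - j %% q) * m + j %% q * (m + nu))%N.
  by rewrite mulnDr addnA -mulnDl subnK// mE mulnA -mulnDl -divn_eq.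
by apply: submonoidD; exact: submonoidM.
Qed.

(** Turns a common bound on the points of all gaps into finiteness of the set of gaps. *)
Lemma finite_powerset_nat (K : nat) :
  finite_set [set G : set nat | G `<=` [set k | (k < K)%N]].
Proof.
pose f (B : {set 'I_K}) : set nat :=
  [set k | exists2 i : 'I_K, i \in B & k = i :> nat].
apply: (@sub_finite_set _ _ (f @` setT)); last exact: finite_image.
move=> G GK; exists [set i : 'I_K | `[< G i >]]%SET => //.
apply/seteqP; split => [k [i]|k Gk]; first by rewrite inE => /asboolP Gi ->.
by exists (Ordinal (GK k Gk)); rewrite ?inE //; apply/asboolP.
Qed.

Section compound_poisson.
Context {R : realType} {d d' : measure_display} {T : measurableType d}
  {T' : measurableType d'} {P : probability T R} {P' : probability T' R}
  (X : {RV P >-> nat}) (lambda : R) (N : {RV P' >-> nat})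
  (Y : nat -> {RV P' >-> nat}).
Hypotheses (lambda_gt0 : 0 < lambda) (XNY : compound_poisson_repr X lambda N Y).

Let A : set nat := supp (distribution P' (Y 0%N)).

Let measurable_preimage (Z : {RV P' >-> nat}) B : measurable (Z @^-1` B).
Proof. by rewrite -[X in measurable X]setTI; exact: measurable_funPT. Qed.

(** The event that the counter equals [size s] and the first jumps are the entries of [s] forces the
    sum to be [sumn s]. By independence its probability is a finite product of positive factors. *)
Lemma submonoid_sub_supp : submonoid A `<=` supp (distribution P X).
Proof.
case: XNY => NE YE _ indep XE _ [s As <-]; rewrite /supp /= XE.
pose B k : set nat := if k is i.+1 then [set nth 0%N s i] else [set size s].
have := indep (iota 0 (size s).+1) B (iota_uniq _ _) (fun=> I).
set E := \bigcap_(i in _) _ => PE.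
apply: (@lt_le_trans _ _ (P' E)); last first.
  apply: le_measure; rewrite ?inE; [|exact: measurable_preimage|].
    by apply: fin_bigcap_measurable => // i _; exact: measurable_preimage.
  move=> w Ew /=; rewrite /random_sum.
  have Ni : N w = size s by exact: (Ew 0%N).
  rewrite Ni sumnE (big_nth 0%N) big_mkord; apply: eq_bigr => i _.
  have si : i.+1 \in iota 0 (size s).+1 by rewrite mem_iota add0n ltnS ltn_ord.
  exact: (Ew i.+1 si).
rewrite PE big_seq; apply: (big_ind (fun x => 0 < x)%E) => [||[_|i]].
- by [].
- exact: mule_gt0.
- change (0 < distribution P' N [set size s])%E.
  rewrite NE lte_fin /poisson_pmf lambda_gt0.
  by rewrite !mulr_gt0 ?exprn_gt0 ?invr_gt0 ?ltr0n ?fact_gt0 ?expR_gt0.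
- rewrite mem_iota add0n ltnS => /= si.
  change (0 < distribution P' (Y i) [set nth 0%N s i])%E.
  by rewrite YE; exact/As/mem_nth.
Qed.

(** Almost surely every jump lies in [A]: the exceptional event is a countable union of null events,
    over the jump index and the value outside [A]. A sum outside the submonoid can occur only on
    that event. *)
Lemma supp_sub_submonoid : supp (distribution P X) `<=` submonoid A.
Proof.
case: XNY => NE YE _ indep XE k; rewrite /supp /= XE => kpos.
apply: contrapT => nAk; move: kpos; rewrite lt_neqAle => /andP[/eqP + _]; apply.
apply/esym; change (P' (random_sum N Y @^-1` [set k]) = 0%E).
apply/negligibleP; first exact: measurable_preimage.
apply: (@negligibleS _ _ _ _ (\bigcup_i \bigcup_j (Y i @^-1` ([set j] `\` A)))).
  move=> w /= wk; apply: contrapT => nw; apply: nAk.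
  exists [seq Y i w | i <- iota 0 (N w)].
    move=> _ /mapP[i _ ->]; apply: contrapT => nA; apply: nw.
    by exists i => //; exists (Y i w).
  rewrite -wk sumnE big_map /random_sum.
  by rewrite -(big_mkord xpredT (Y ^~ w)) /index_iota subn0.
apply: negligible_bigcup => i; apply: negligible_bigcup => j.
apply/negligibleP; first exact: measurable_preimage.
change (distribution P' (Y i) ([set j] `\` A) = 0%E); rewrite YE.
have [Aj|nAj] := pselect (A j).
  by rewrite (_ : _ `\` _ = set0) ?measure0//; apply/seteqP; split => // _ [->].
rewrite (_ : _ `\` _ = [set j]); last first.
  by apply/seteqP; split => [_ [->]|_ ->].
apply/eqP; move/negP: nAj; rewrite -leNgt => nAj.
by rewrite eq_le nAj measure_ge0.
Qed.

Lemma supp_compound_poisson : supp (distribution P X) = submonoid A.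
Proof.
by apply/seteqP; split; [exact: supp_sub_submonoid|exact: submonoid_sub_supp].
Qed.

End compound_poisson.

Theorem theorem11 (R : realType)
    (d : measure_display) (T : measurableType d) (P : probability T R)
    (X : {RV P >-> nat})
    (d' : measure_display) (T' : measurableType d') (P' : probability T' R)
    (lambda : R) (N : {RV P' >-> nat}) (Y : nat -> {RV P' >-> nat})
    (nu : nat) :
  discretely_infinitely_divisible X ->
  0 < lambda ->
  compound_poisson_repr X lambda N Y ->
  (0 < nu)%N ->
  is_gcd_of (supp (distribution P' (Y 0%N))) nu ->
  finite_set [set G | is_gap nu (supp (distribution P X)) G] /\
  (no_gaps nu (supp (distribution P X)) <->
   (0 < distribution P X [set nu])%E).
Proof.
move=> _ lambda0 XNY nu0 gA.
have SE := supp_compound_poisson X lambda N Y lambda0 XNY.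
split.
  have [K AK] := submonoid_cofinite _ nu nu0 gA.
  apply: sub_finite_set (finite_powerset_nat (K * nu)).
  (* A point [j * nu] of a gap with [K <= j] would belong to the support, which the gap avoids. *)
  move=> G [[_ Gnu _ GS] _] k Gk; have [j _ jk] := Gnu k Gk.
  rewrite /= -jk ltn_pmul2r// ltnNge; apply/negP => /AK Aj.
  by suff : (set0 : set nat) k by []; rewrite -GS SE; split => //; rewrite -jk.
change (no_gaps nu (supp (distribution P X)) <-> supp (distribution P X) nu).
rewrite SE; split => [/(_ 1%N)|Anu j]; first by rewrite mul1n.
exact: submonoidM.
Qed.
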